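(* Let $\overline{A_1A_2A_3}$ be a triangle in the Euclidean plane $\mathbb{R}^2$ with quadrances $Q_1,Q_2,Q_3$ and spreads $s_1,s_2,s_3$, and let $\mathrm{area}$ denote its area. Then $$\frac{s_1}{Q_1}=\frac{s_2}{Q_2}=\frac{s_3}{Q_3}=\frac{4\,\mathrm{area}^{2}}{Q_1Q_2Q_3}.$$
   Context: The quadrance between points $A=[x_1,y_1]$ and $B=[x_2,y_2]$ of the real Euclidean plane is $Q(A,B)=(x_2-x_1)^2+(y_2-y_1)^2$. The spread $s(l_1,l_2)$ between two lines $l_1,l_2$ is defined as follows. If $l_1$ and $l_2$ are parallel, $s(l_1,l_2)=0$. If they intersect at a point $A$, choose a point $B\neq A$ on $l_1$ and let $C$ be the foot of the perpendicular from $B$ to $l_2$; then $s(l_1,l_2)=Q(B,C)/Q(A,B)$, which is independent of the choice of $B$ (perpendicular lines have spread $1$). Equivalently, if the lines have equations $a_1x+b_1y+c_1=0$ and $a_2x+b_2y+c_2=0$, then $s(l_1,l_2)=\dfrac{(a_1b_2-a_2b_1)^2}{(a_1^2+b_1^2)(a_2^2+b_2^2)}$. A triangle $\overline{A_1A_2A_3}$ is given by three non-collinear points. Its quadrances are $Q_1=Q(A_2,A_3)$, $Q_2=Q(A_1,A_3)$, $Q_3=Q(A_1,A_2)$, and its spreads are $s_1=s(A_1A_2,A_1A_3)$, $s_2=s(A_2A_1,A_2A_3)$, $s_3=s(A_3A_1,A_3A_2)$, where $A_iA_j$ denotes the line through $A_i$ and $A_j$ (so $s_i$ is the spread at vertex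 $A_i$, opposite the side with quadrance $Q_i$). *)

(* Defs.v *)
From HB Require Import structures.
From mathcomp Require Import all_boot all_order all_algebra.
From mathcomp Require Import all_classical all_reals all_analysis.

Set Implicit Arguments.
Unset Strict Implicit.
Unset Printing Implicit Defensive.

Import Order.TTheory GRing.Theory Num.Theory.

Local Open Scope classical_set_scope.
Local Open Scope ring_scope.

Definition quadrance (R : realType) (A B : R * R) : R :=
  (B.1 - A.1) ^+ 2 + (B.2 - A.2) ^+ 2.

(* For A = B this is the single point A. *)
Definition line_through (R : realType) (A B : R * R) : set (R * R) :=
  [set P | exists t : R,
     P = (A.1 + t * (B.1 - A.1), A.2 + t * (B.2 - A.2))].

Definition is_line (R : realType) (l : set (R * R)) : Prop :=
  exists A B : R * R, A <> B /\ l = line_through A B.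

Definition collinear (R : realType) (A B C : R * R) : Prop :=
  exists l : set (R * R), is_line l /\ [/\ l A, l B & l C].

(* A line is parallel to itself. *)
Definition parallel (R : realType) (l1 l2 : set (R * R)) : Prop :=
  l1 = l2 \/ l1 `&` l2 = set0.

(* The segment BC is perpendicular to every segment CD with D on l. *)
Definition perp_foot (R : realType) (B : R * R) (l : set (R * R))
    (C : R * R) : Prop :=
  l C /\ forall D : R * R, l D ->
    (B.1 - C.1) * (D.1 - C.1) + (B.2 - C.2) * (D.2 - C.2) = 0.

(* For two non-parallel lines, [xget] chooses the intersection point A, some
   point B <> A of l1, and the foot C of the perpendicular from B to l2; the
   default point (0, 0) is then never used. *)
Definition spread (R : realType) (l1 l2 : set (R * R)) : R :=
  if `[< parallel l1 l2 >] then 0 else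
  let A := xget (0, 0) (l1 `&` l2) in
  let B := xget (0, 0) (l1 `\ A) in
  let C := xget (0, 0) (perp_foot B l2) in
  quadrance B C / quadrance A B.

Definition triangle_region (R : realType) (A B C : R * R) : set (R * R) :=
  [set P | exists a b c : R,
     [/\ 0 <= a, 0 <= b, 0 <= c, a + b + c = 1
       & P = (a * A.1 + b * B.1 + c * C.1, a * A.2 + b * B.2 + c * C.2)]].

(* The triangle is compact, so [fine] is applied to a finite value. *)
Definition area (R : realType) (A B C : R * R) : R :=
  fine ((@lebesgue_measure R \x @lebesgue_measure R)%E (triangle_region A B C)).

(* Main.v *)
Require Import Defs.
From mathcomp Require Import all_boot all_order all_algebra.
From mathcomp Require Import all_classical all_reals all_analysis.
From mathcomp Require Import measurable_realfun ring lra.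

Set Implicit Arguments.
Unset Strict Implicit.
Unset Printing Implicit Defensive.

Import Order.TTheory GRing.Theory Num.Theory.
Import numFieldNormedType.Exports.

Local Open Scope ring_scope.

(** Put D = cross A1 A2 A3, the determinant of the vectors A1A2 and A1A3. The
    three ratios and the right-hand side all equal D ^ 2 / (Q1 * Q2 * Q3).

    For the ratios, the foot F of the perpendicular from a point P to the line
    AC is an orthogonal projection, given by an explicit dot product
    ([perp_foot_line_through]). Lagrange's identity
    |v| ^ 2 * |w| ^ 2 - (v . w) ^ 2 = (v x w) ^ 2 then turns the quotient
    Q(P, F) / Q(A, P) into (v x w) ^ 2 / (|v| ^ 2 * |w| ^ 2), with v and w
    directing AB and AC ([spread_line_through]). Up to sign D does not depend
    on the vertex chosen as the origin, so dividing s_i by Q_i puts the same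
    D ^ 2 over the product of the three quadrances.

    For the right-hand side one needs area = |D| / 2 ([area_cross]). Lebesgue
    measure on the plane integrates the lengths of the vertical sections of the
    triangle. When the vertices are sorted by abscissa, this length is a tent
    function of x: it grows linearly from 0 at the first vertex to
    |D| / (x3 - x1) at the second one and decreases linearly to 0 at the third.
    The integral of the tent is |D| / 2. *)

(** * Determinants and collinearity *)

(** Twice the signed area of the triangle ABC. *)
Definition cross (R : realType) (A B C : R * R) : R :=
  (B.1 - A.1) * (C.2 - A.2) - (C.1 - A.1) * (B.2 - A.2).

Lemma quadrance_gt0 (R : realType) (A B : R * R) :
  A <> B -> 0 < quadrance A B.
Proof.
move=> AB; rewrite lt_neqAle eq_sym /quadrance addr_ge0 ?sqr_ge0 // andbT.
apply/eqP => /eqP; rewrite paddr_eq0 ?sqr_ge0 // !sqrf_eq0 !subr_eq0.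
by move=> /andP[/eqP h1 /eqP h2]; apply: AB; apply: injective_projections.
Qed.

Lemma quadrance_sym (R : realType) (A B : R * R) :
  quadrance A B = quadrance B A.
Proof. rewrite /quadrance; ring. Qed.

Lemma cross_neq0_neq (R : realType) (A B C : R * R) :
  cross A B C != 0 -> A <> B /\ A <> C.
Proof.
by rewrite /cross => /eqP h; split => E; apply: h; rewrite E; ring.
Qed.

Lemma line_throughl (R : realType) (A B : R * R) : line_through A B A.
Proof. by exists 0; rewrite !mul0r !addr0 -surjective_pairing. Qed.

Lemma line_throughr (R : realType) (A B : R * R) : line_through A B B.
Proof. by exists 1; rewrite !mul1r !subrKC -surjective_pairing. Qed.

(** The parameter of C on the line AB is that of its projection on AB; the
    error made is the vector AB turned by a right angle, times
    cross A B C / Q(A, B). *)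
Lemma cross0_line_through (R : realType) (A B C : R * R) :
  A <> B -> cross A B C = 0 -> line_through A B C.
Proof.
move=> AB c0; have q0 : quadrance A B != 0 by rewrite gt_eqF ?quadrance_gt0.
exists (((C.1 - A.1) * (B.1 - A.1) + (C.2 - A.2) * (B.2 - A.2))
        / quadrance A B).
move: c0 q0; rewrite /cross /quadrance => c0 q0.
apply: injective_projections => /=; apply/eqP; rewrite -subr_eq0; apply/eqP.
- transitivity (- (B.2 - A.2) / ((B.1 - A.1) ^+ 2 + (B.2 - A.2) ^+ 2) *
    ((B.1 - A.1) * (C.2 - A.2) - (C.1 - A.1) * (B.2 - A.2))); first by field.
  by rewrite c0 mulr0.
- transitivity ((B.1 - A.1) / ((B.1 - A.1) ^+ 2 + (B.2 - A.2) ^+ 2) *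
    ((B.1 - A.1) * (C.2 - A.2) - (C.1 - A.1) * (B.2 - A.2))); first by field.
  by rewrite c0 mulr0.
Qed.

Lemma cross_neq0_noncollinear (R : realType) (A B C : R * R) :
  ~ collinear A B C -> cross A B C != 0.
Proof.
move=> hABC; apply/eqP => c0; apply: hABC.
have [AB|/eqP AB] := eqVneq A B; last first.
  exists (line_through A B); split; first by exists A, B.
  by split; [exact: line_throughl|exact: line_throughr|
             exact: cross0_line_through].
(* When A = B any line through A and C will do, even if C = A. *)
have [D [AD DC]] : exists D, A <> D /\ line_through A D C.
  have [AC|/eqP AC] := eqVneq A C; last first.
    by exists C; split => //; exact: line_throughr.
  exists (A.1 + 1, A.2); split; last by rewrite -AC; exact: line_throughl.
  move=> /(congr1 fst) /= /eqP.
  by rewrite -subr_eq0 opprD addNKr oppr_eq0 oner_eq0.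
exists (line_through A D); split; first by exists A, D.
by rewrite -AB; split => //; exact: line_throughl.
Qed.

(** * Spreads *)

Lemma line_through_meet (R : realType) (A B C : R * R) : cross A B C != 0 ->
  (line_through A B `&` line_through A C)%classic = [set A]%classic.
Proof.
move=> c0; apply/seteqP; split => [P [[t ->] [s]]|_ ->]; last first.
  by split; exact: line_throughl.
move=> /= [] /addrI e1 /addrI e2.
have : t * cross A B C = 0.
  rewrite /cross mulrBr mulrA e1 [X in _ - X]mulrCA e2; ring.
move=> /eqP; rewrite mulf_eq0 (negbTE c0) orbF => /eqP ->.
by rewrite !mul0r !addr0 -surjective_pairing.
Qed.

(** The foot exists and is unique: orthogonality to AC determines the parameter
    of F on AC, and testing it against the points A and C is enough. *)
Lemma perp_foot_line_through (R : realType) (A C P F : R * R) :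
  A <> C -> let tau :=
    ((P.1 - A.1) * (C.1 - A.1) + (P.2 - A.2) * (C.2 - A.2)) / quadrance A C in
  perp_foot P (line_through A C) F <->
  F = (A.1 + tau * (C.1 - A.1), A.2 + tau * (C.2 - A.2)).
Proof.
move=> AC tau; have q0 : quadrance A C != 0 by rewrite gt_eqF ?quadrance_gt0.
have tauE : tau * quadrance A C =
    (P.1 - A.1) * (C.1 - A.1) + (P.2 - A.2) * (C.2 - A.2) by rewrite divfK.
split=> [[[s ->]] perp|->].
  suff -> : s = tau by [].
  apply: (mulIf q0); rewrite tauE.
  have := perp _ (line_throughl A C); have := perp _ (line_throughr A C).
  rewrite /= /quadrance => h1 h2; lra.
split=> [|_ [s ->] /=]; first by exists tau.
transitivity ((s - tau) * ((P.1 - A.1) * (C.1 - A.1)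
  + (P.2 - A.2) * (C.2 - A.2) - tau * quadrance A C)).
  rewrite /quadrance; ring.
by rewrite tauE subrr mulr0.
Qed.

(** The auxiliary point P chosen on AB is A + t (B - A) for an unknown t <> 0;
    both quadrances scale by t ^ 2, so t cancels in the quotient. *)
Lemma spread_line_through (R : realType) (A B C : R * R) : cross A B C != 0 ->
  spread (line_through A B) (line_through A C) =
  cross A B C ^+ 2 / (quadrance A B * quadrance A C).
Proof.
move=> c0; have [AB AC] := cross_neq0_neq c0.
have meet := line_through_meet c0.
rewrite /spread asboolF; last first.
  case=> [l12|]; rewrite ?meet; last first.
    by move=> /seteqP[/(_ A erefl)].
  apply: AB; suff : [set A]%classic B by [].
  by rewrite -meet -l12 setIid; exact: line_throughr.
rewrite meet (@xget_unique _ (0, 0) [set A]%classic A) //.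
set P := xget _ (_ `\ A)%classic.
have [[t Pt] /= PA] : (line_through A B `\ A)%classic P.
  by apply: xgetPex; exists B; split; [exact: line_throughr|exact/nesym].
have t0 : t != 0.
  apply/eqP => t0; apply: PA.
  by rewrite Pt t0 !mul0r !addr0 -surjective_pairing.
have Q1 : quadrance A B != 0 by rewrite gt_eqF ?quadrance_gt0.
have Q2 : quadrance A C != 0 by rewrite gt_eqF ?quadrance_gt0.
have footP F := @perp_foot_line_through _ A C P F AC.
rewrite (xget_unique _ ((footP _).2 erefl) (fun F => (footP F).1)).
rewrite {}Pt /cross; rewrite /quadrance /= in Q1 Q2 *.
(* The last side condition is quadrance A P != 0, which is t ^ 2 times that of
   A and B. *)
by field; rewrite Q1 Q2 /=; move: (mulf_neq0 (expf_neq0 2 t0) Q1);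
  congr (_ != 0); ring.
Qed.

(** * Integrals and lengths on the real line *)

Lemma continuous_affine (R : realType) (c e : R) :
  continuous (fun x : R => c * (x - e)).
Proof.
move=> x; apply: cvgM; first exact: cvg_cst.
by apply: cvgB; [exact: cvg_id|exact: cvg_cst].
Qed.

Lemma measurable_affine (R : realType) (c e : R) (D : set R) :
  measurable_fun D (fun x : R => (c * (x - e))%:E).
Proof.
apply/measurable_EFinP; apply: measurable_funTS.
by apply: continuous_measurable_fun; exact: continuous_affine.
Qed.

(** The bounds may be open or closed, so that the pieces of a piecewise affine
    function can be made disjoint. *)
Lemma integral_affine (R : realType) (a b c e : R) (s1 s2 : bool) : a <= b ->
  (\int[lebesgue_measure]_(x in [set` Interval (BSide s1 a) (BSide s2 b)])
     (c * (x - e))%:E = (c / 2 * ((b - e) ^+ 2 - (a - e) ^+ 2))%:E)%E.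
Proof.
move=> ab.
have mf D := @measurable_affine R c e D.
rewrite integral_itv_bndoo // -(integral_itv_bndoo true false) //.
move: ab; rewrite le_eqVlt => /predU1P[->|ab].
  by rewrite set_itv1 integral_set1 subrr mulr0.
pose F (x : R) := c / 2 * (x - e) ^+ 2.
have dF (x : R) : is_derive x 1 F (c * (x - e)).
  rewrite /F; apply: is_derive_eq.
  by rewrite subr0 /GRing.scale /=; field.
rewrite (@continuous_FTC2 _ _ F) //.
- by rewrite /F -EFinB mulrBr.
- by apply: continuous_subspaceT; exact: continuous_affine.
- split.
  + by move=> x _; exact: (@ex_derive _ _ _ _ _ _ _ (dF x)).
  + apply: cvg_at_right_filter; apply: differentiable_continuous.
    by apply/derivable1_diffP; exact: (@ex_derive _ _ _ _ _ _ _ (dF a)).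
  + apply: cvg_at_left_filter; apply: differentiable_continuous.
    by apply/derivable1_diffP; exact: (@ex_derive _ _ _ _ _ _ _ (dF b)).
- by move=> x _; rewrite derive1E; exact: derive_val.
Qed.

Lemma lebesgue_measure_segment (R : realType) (p k t : R) : 0 <= t ->
  lebesgue_measure [set p + r * k | r in `[0, t]%classic]%classic =
  (t * `|k|)%:E.
Proof.
move=> t0; pose m := Num.min p (p + t * k); pose M := Num.max p (p + t * k).
have MmE : M - m = t * `|k|.
  rewrite /M /m; have [k0|k0] := leP 0 k.
    have h := mulr_ge0 t0 k0; rewrite max_r ?min_l ?lerDl // ger0_norm //; ring.
  have h := mulr_ge0 t0 (ltW (eqbRL (oppr_gt0 k) k0)).
  by rewrite ltr0_norm // max_l ?min_r; [ring| |]; lra.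
have -> : [set p + r * k | r in `[0, t]%classic]%classic = `[m, M]%classic.
  apply/seteqP; split => [_ [r /= + <-]|y /=].
    rewrite !in_itv /= /m /M => /andP[r0 rt].
    have [k0|k0] := leP 0 k.
      have h1 := mulr_ge0 r0 k0; have h2 := ler_wpM2r k0 rt.
      by rewrite max_r ?min_l; [apply/andP; split| |]; lra.
    have h1 := mulr_ge0_le0 r0 (ltW k0); have h2 := ler_wnM2r (ltW k0) rt.
    by rewrite max_l ?min_r; [apply/andP; split| |]; lra.
  rewrite in_itv /= /m /M => /andP[y1 y2].
  have [k0|k0|k0] := ltgtP k 0.
  - have h := mulr_ge0_le0 t0 (ltW k0).
    rewrite min_r in y1; last lra. rewrite max_l in y2; last lra.
    exists ((y - p) / k); last by rewrite divfK ?lt_eqF // subrKC.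
    rewrite /= in_itv /= ler_ndivlMr // ler_ndivrMr // mul0r.
    by apply/andP; split; lra.
  - have h := mulr_ge0 t0 (ltW k0).
    rewrite min_l in y1; last lra. rewrite max_r in y2; last lra.
    exists ((y - p) / k); last by rewrite divfK ?gt_eqF // subrKC.
    rewrite /= in_itv /= ler_pdivlMr // ler_pdivrMr // mul0r.
    by apply/andP; split; lra.
  - exists 0; first by rewrite /= in_itv /= lexx.
    move: y1 y2; rewrite k0 !mulr0 !addr0 minxx maxxx => y1 y2.
    by apply/le_anti/andP.
have mM : m <= M by rewrite -subr_ge0 MmE mulr_ge0.
rewrite lebesgue_measure_itv /= lte_fin; case: ltP => [_|Mm].
  by rewrite -EFinB MmE.
by rewrite -MmE; congr EFin; apply/esym/eqP; rewrite subr_eq0 eq_le mM Mm.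
Qed.

(** * Vertical sections of a triangle *)

Lemma triangle_region_swap12 (R : realType) (A B C : R * R) :
  triangle_region A B C = triangle_region B A C.
Proof.
suff sub X Y : (triangle_region X Y C `<=` triangle_region Y X C)%classic.
  by apply/seteqP; split; exact: sub.
move=> P [a [b [c [a0 b0 c0 abc ->]]]]; exists b, a, c; split => //.
- by rewrite (addrC b).
- by rewrite (addrC (a * X.1)) (addrC (a * X.2)).
Qed.

Lemma triangle_region_swap23 (R : realType) (A B C : R * R) :
  triangle_region A B C = triangle_region A C B.
Proof.
suff sub X Y : (triangle_region A X Y `<=` triangle_region A Y X)%classic.
  by apply/seteqP; split; exact: sub.
move=> P [a [b [c [a0 b0 c0 abc ->]]]]; exists a, c, b; split => //.
- by rewrite addrAC.
- by congr (_, _); rewrite addrAC.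
Qed.

(** Let B lie between A and C in abscissa, on either side of A. At abscissa
    A.1 + t (B.1 - A.1) a point with weights a, b, c satisfies c = (t - b) u,
    so r = t - b is the only freedom left. The value r = 0 gives the point on
    AB and r = t the one on AC. The sign of C.1 - A.1 is left free so that the
    lemma applies from the leftmost as well as from the rightmost vertex. *)
Lemma triangle_section (R : realType) (A B C : R * R) (t u : R) :
  0 <= t <= 1 -> 0 < u <= 1 -> C.1 != A.1 ->
  B.1 - A.1 = u * (C.1 - A.1) ->
  xsection (triangle_region A B C) (A.1 + t * (B.1 - A.1)) =
  [set (A.2 + t * (B.2 - A.2)) + r * (cross A B C / (C.1 - A.1))
     | r in `[0, t]%classic]%classic.
Proof.
move=> /andP[t0 t1] /andP[u0 u1] CA Bu.
have D0 : C.1 - A.1 != 0 by rewrite subr_eq0.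
have kE : cross A B C / (C.1 - A.1) = u * (C.2 - A.2) - (B.2 - A.2).
  by rewrite /cross Bu; field.
rewrite {}kE; apply/seteqP; split => y /=; rewrite /xsection /= ?inE.
  move=> [a [b [c [a0 b0 c0 abc [xE ->]]]]].
  have aE : a = 1 - b - c by lra.
  have cE : c = (t - b) * u.
    by apply: (mulIf D0); rewrite -mulrA -Bu; rewrite aE in xE; lra.
  exists (t - b); last by rewrite aE cE; ring.
  rewrite /= in_itv /=; apply/andP; split; last by lra.
  by move: c0; rewrite cE pmulr_lge0.
move=> [r /=]; rewrite in_itv /= => /andP[r0 rt] <-.
exists (1 - (t - r) - r * u), (t - r), (r * u); split.
- have : r * (1 - u) >= 0 by rewrite mulr_ge0 // subr_ge0.
  lra.
- by rewrite subr_ge0.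
- by rewrite mulr_ge0 // ltW.
- ring.
- congr (_, _); last ring.
  have -> : B.1 = A.1 + u * (C.1 - A.1) by rewrite -Bu subrKC.
  ring.
Qed.

Lemma triangle_section_measure (R : realType) (A B C : R * R) (x : R) :
  0 <= (x - A.1) / (B.1 - A.1) <= 1 ->
  0 < (B.1 - A.1) / (C.1 - A.1) <= 1 ->
  lebesgue_measure (xsection (triangle_region A B C) x) =
  ((x - A.1) / (B.1 - A.1) * `|cross A B C / (C.1 - A.1)|)%:E.
Proof.
set t := (x - A.1) / _; set u := _ / (C.1 - A.1) => t01 u01.
have [BA CA] : B.1 - A.1 != 0 /\ C.1 - A.1 != 0.
  by split; apply/eqP => z; move: u01; rewrite /u z ?invr0 ?mulr0 ?mul0r ltxx.
have -> : x = A.1 + t * (B.1 - A.1) by rewrite /t divfK // subrKC.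
rewrite (triangle_section _ u01) //.
- by rewrite lebesgue_measure_segment //; case/andP: t01.
- by rewrite -subr_eq0.
- by rewrite /u divfK.
Qed.

Lemma triangle_section_out (R : realType) (A B C : R * R) (x : R) :
  A.1 <= B.1 -> B.1 <= C.1 -> ~~ (A.1 <= x <= C.1) ->
  xsection (triangle_region A B C) x = set0.
Proof.
move=> AB BC out; rewrite -subset0 => y; rewrite /xsection /= inE.
move=> [a [b [c [a0 b0 c0 abc [xE _]]]]]; apply: (negP out).
have aE : a = 1 - b - c by lra.
have h1 := mulr_ge0 b0 (eqbRL (subr_ge0 _ _) AB).
have h2 := mulr_ge0 b0 (eqbRL (subr_ge0 _ _) BC).
have h3 := mulr_ge0 a0 (eqbRL (subr_ge0 _ _) (le_trans AB BC)).
have h4 := mulr_ge0 c0 (eqbRL (subr_ge0 _ _) (le_trans AB BC)).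
rewrite xE; apply/andP; split; rewrite -subr_ge0.
  suff -> : a * A.1 + b * B.1 + c * C.1 - A.1 =
    b * (B.1 - A.1) + c * (C.1 - A.1) by rewrite addr_ge0.
  by rewrite aE; ring.
suff -> : C.1 - (a * A.1 + b * B.1 + c * C.1) =
    b * (C.1 - B.1) + a * (C.1 - A.1) by rewrite addr_ge0.
by rewrite aE; ring.
Qed.

Lemma triangle_section_left (R : realType) (A B C : R * R) (x : R) :
  A.1 <= x < B.1 -> B.1 <= C.1 ->
  lebesgue_measure (xsection (triangle_region A B C) x) =
  (`|cross A B C| / ((B.1 - A.1) * (C.1 - A.1)) * (x - A.1))%:E.
Proof.
move=> /andP[Ax xB] BC.
have AB : 0 < B.1 - A.1 by lra.
have AC : 0 < C.1 - A.1 by lra.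
rewrite triangle_section_measure.
- congr EFin; rewrite normrM normfV (gtr0_norm AC) invfM; ring.
- by rewrite ler_pdivlMr // ler_pdivrMr // mul0r mul1r; apply/andP; split; lra.
- by rewrite ltr_pdivlMr // ler_pdivrMr // mul0r mul1r; apply/andP; split; lra.
Qed.

Lemma triangle_section_right (R : realType) (A B C : R * R) (x : R) :
  A.1 <= B.1 -> B.1 < x <= C.1 ->
  lebesgue_measure (xsection (triangle_region A B C) x) =
  (- (`|cross A B C| / ((C.1 - B.1) * (C.1 - A.1))) * (x - C.1))%:E.
Proof.
move=> AB /andP[Bx xC].
have BC : B.1 - C.1 < 0 by lra.
have AC : A.1 - C.1 < 0 by lra.
have -> : triangle_region A B C = triangle_region C B A.
  rewrite triangle_region_swap12 triangle_region_swap23.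
  exact: triangle_region_swap12.
rewrite triangle_section_measure.
- have -> : cross C B A = - cross A B C by rewrite /cross; ring.
  congr EFin; rewrite normrM normfV normrN (ltr0_norm AC) !opprB.
  have neq : [&& C.1 - A.1 != 0, C.1 - B.1 != 0 & B.1 - C.1 != 0].
    by apply/and3P; split; lra.
  by field; exact: neq.
- by rewrite ler_ndivlMr // ler_ndivrMr // mul0r mul1r; apply/andP; split; lra.
- by rewrite ltr_ndivlMr // ler_ndivrMr // mul0r mul1r; apply/andP; split; lra.
Qed.

(** * The area of a triangle *)

(** The tent function is cut into its two slopes, on [A.1, B.1[ and ]B.1, C.1],
    and the single abscissa B.1, which is negligible. Leaving out B.1
    makes the formulas of the two slopes valid even when one of the sides AB
    and BC is vertical, since the corresponding interval is then empty. *)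
Lemma area_sorted (R : realType) (A B C : R * R) :
  A.1 <= B.1 -> B.1 <= C.1 -> area A B C = `|cross A B C| / 2.
Proof.
move=> AB BC; rewrite /area /product_measure1.
set f := (_ \o _).
pose c1 := `|cross A B C| / ((B.1 - A.1) * (C.1 - A.1)).
pose c2 := `|cross A B C| / ((C.1 - B.1) * (C.1 - A.1)).
pose g1 := ((fun x : R => (c1 * (x - A.1))%:E) \_ `[A.1, B.1[%classic)%classic.
pose g0 := (cst (f B.1) \_ [set B.1])%classic.
pose g2 :=
  ((fun x : R => (- c2 * (x - C.1))%:E) \_ `]B.1, C.1]%classic)%classic.
have c1_ge0 : 0 <= c1.
  by rewrite divr_ge0 // mulr_ge0 // subr_ge0 // (le_trans AB).
have c2_ge0 : 0 <= c2.
  by rewrite divr_ge0 // mulr_ge0 // subr_ge0 // (le_trans AB).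
have fE : f = (fun x => g1 x + (g0 x + g2 x))%E.
  apply/funext => x; rewrite /g1 /g0 /g2 !patchE.
  rewrite !mem_setE classical_sets.in_set1 /=.
  rewrite !in_itv /=; have [xB|xB|->] := ltgtP x B.1.
  - rewrite /= andbT !adde0; case: ifPn => [Ax|xA].
      by rewrite /f /= triangle_section_left // Ax xB.
    by rewrite /f /= triangle_section_out ?measure0 // (negbTE xA).
  - rewrite /= andbF !add0e; case: ifPn => [xC|Cx].
      by rewrite /f /= triangle_section_right // xB xC.
    by rewrite /f /= triangle_section_out ?measure0 // (negbTE Cx) andbF.
  - by rewrite andbF add0e adde0.
have g1_ge0 x : setT x -> (0 <= g1 x)%E.
  move=> _; rewrite /g1 patchE mem_setE in_itv /=; case: ifPn => // /andP[h _].
  by rewrite lee_fin mulr_ge0 // subr_ge0.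
have g0_ge0 x : setT x -> (0 <= g0 x)%E.
  by move=> _; rewrite /g0 patchE; case: ifPn.
have g2_ge0 x : setT x -> (0 <= g2 x)%E.
  move=> _; rewrite /g2 patchE mem_setE in_itv /=; case: ifPn => // /andP[_ h].
  by rewrite lee_fin mulNr -mulrN mulr_ge0 // opprB subr_ge0.
have mg1 : measurable_fun setT g1.
  by apply: (measurable_restrictT _ _).1 => //; exact: measurable_affine.
have mg0 : measurable_fun setT g0.
  by apply: (measurable_restrictT _ _).1 => //; exact: measurable_cst.
have mg2 : measurable_fun setT g2.
  by apply: (measurable_restrictT _ _).1 => //; exact: measurable_affine.
rewrite fE ge0_integralD //; last 2 first.
- by move=> x _; rewrite adde_ge0 ?g0_ge0 ?g2_ge0.
- exact: emeasurable_funD.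
rewrite ge0_integralD // -!integral_mkcond integral_set1 add0e.
rewrite !integral_affine //.
rewrite /= !subrr expr0n /= subr0 sub0r.
(* If all the vertices have the same abscissa, c1 and c2 divide by zero, but
   the determinant vanishes. *)
have [AC|AC] := eqVneq (C.1 - A.1) 0.
  have d0 : cross A B C = 0.
    have BA : B.1 - A.1 = 0 by lra.
    by rewrite /cross AC BA !mul0r subr0.
  by rewrite /c1 /c2 d0 normr0 !mul0r oppr0 !mul0r addr0.
have c1E : c1 * (B.1 - A.1) ^+ 2 = `|cross A B C| * (B.1 - A.1) / (C.1 - A.1).
  rewrite /c1; have [->|BA] := eqVneq (B.1 - A.1) 0.
    by rewrite !(mulr0, mul0r, expr0n).
  by field; apply/andP.
have c2E : c2 * (B.1 - C.1) ^+ 2 = `|cross A B C| * (C.1 - B.1) / (C.1 - A.1).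
  rewrite /c2 -sqrrN opprB.
  have [->|BC0] := eqVneq (C.1 - B.1) 0.
    by rewrite !(mulr0, mul0r, expr0n).
  by field; apply/andP.
transitivity ((c1 * (B.1 - A.1) ^+ 2 + c2 * (B.1 - C.1) ^+ 2) / 2).
  by field.
by rewrite c1E c2E; field.
Qed.

(** Both sides are invariant under permutation of the vertices, hence these may
    be assumed to be sorted by abscissa. *)
Lemma area_cross (R : realType) (A B C : R * R) :
  area A B C = `|cross A B C| / 2.
Proof.
have swap12 X Y Z :
    area X Y Z = `|cross X Y Z| / 2 -> area Y X Z = `|cross Y X Z| / 2.
  rewrite /area triangle_region_swap12 => ->; congr (_ / _).
  by rewrite -normrN /cross; congr `|_|; ring.
have swap23 X Y Z :
    area X Y Z = `|cross X Y Z| / 2 -> area X Z Y = `|cross X Z Y| / 2.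
  rewrite /area triangle_region_swap23 => ->; congr (_ / _).
  by rewrite -normrN /cross; congr `|_|; ring.
have [AB|/ltW BA] := leP A.1 B.1; have [BC|/ltW CB] := leP B.1 C.1.
- exact: area_sorted.
- have [AC|/ltW CA] := leP A.1 C.1.
  + exact/swap23/area_sorted.
  + exact/swap23/swap12/area_sorted.
- have [AC|/ltW CA] := leP A.1 C.1.
  + exact/swap12/area_sorted.
  + exact/swap12/swap23/area_sorted.
- exact/swap12/swap23/swap12/area_sorted.
Qed.

Theorem theorem5 (R : realType) (A1 A2 A3 : R * R)
    (hA : ~ collinear A1 A2 A3) :
  let Q1 := quadrance A2 A3 in
  let Q2 := quadrance A1 A3 in
  let Q3 := quadrance A1 A2 in
  let s1 := spread (line_through A1 A2) (line_through A1 A3) in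
  let s2 := spread (line_through A2 A1) (line_through A2 A3) in
  let s3 := spread (line_through A3 A1) (line_through A3 A2) in
  [/\ s1 / Q1 = s2 / Q2,
      s2 / Q2 = s3 / Q3
    & s3 / Q3 = 4 * area A1 A2 A3 ^+ 2 / (Q1 * Q2 * Q3)].
Proof.
move=> Q1 Q2 Q3 s1 s2 s3.
have c0 := cross_neq0_noncollinear hA.
have cE2 : cross A2 A1 A3 = - cross A1 A2 A3 by rewrite /cross; ring.
have cE3 : cross A3 A1 A2 = cross A1 A2 A3 by rewrite /cross; ring.
have s1E : s1 = cross A1 A2 A3 ^+ 2 / (Q3 * Q2) by exact: spread_line_through.
have s2E : s2 = cross A1 A2 A3 ^+ 2 / (Q3 * Q1).
  by rewrite /s2 spread_line_through cE2 ?oppr_eq0 // sqrrN (quadrance_sym A2).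
have s3E : s3 = cross A1 A2 A3 ^+ 2 / (Q2 * Q1).
  rewrite /s3 spread_line_through cE3 //.
  by rewrite (quadrance_sym A3 A1) (quadrance_sym A3).
have areaE : 4 * area A1 A2 A3 ^+ 2 = cross A1 A2 A3 ^+ 2.
  by rewrite area_cross expr_div_n -normrX ger0_norm ?sqr_ge0 //; field.
rewrite s1E s2E s3E areaE !invfM.
by split; ring.
Qed.
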